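(* Let $n\ge1$ and $m\ge 1$ be integers, and let $\Gamma=([n],A(\Gamma))$ be a simple digraph. Put $$P(\Gamma,z)=\sum_{k=1}^{n}\mathrm{path}_k(\Gamma)\,z^{\underline{k-1}},\qquad \mathcal C_n^{m,m}(\Gamma)=\mathcal C_n^m\setminus\{x_i-x_j=m\mid (i,j)\in A(\Gamma)\}.$$ Then for integers $\alpha_1,\dots,\alpha_{n-1}$ one has $$P(\Gamma,z)=\prod_{j=1}^{n-1}(z+\alpha_j)$$ if and only if the same integers satisfy $$\chi(\mathcal C_n^{m,m}(\Gamma),t)=t\prod_{j=1}^{n-1}(t-mn-1+\alpha_j).$$ Consequently, for fixed $\Gamma$, whether $\chi(\mathcal C_n^{m,m}(\Gamma),t)$ factors into integer linear factors is independent of $m\ge1$, and changing $m$ only translates the nonzero roots: for any $m,m'\ge1$ the multiset of nonzero complex roots of $\chi(\mathcal C_n^{m',m'}(\Gamma),t)$ is a translate by a constant of the multiset of nonzero complex roots of $\chi(\mathcal C_n^{m,m}(\Gamma),t)$.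
   Context: Notation: $[n]=\{1,\dots,n\}$. Falling factorial: $x^{\underline r}=x(x-1)\cdots(x-r+1)$, $x^{\underline 0}=1$. The full $m$-Catalan arrangement in $\mathbb R^n$ is the set of hyperplanes $$\mathcal C_n^m=\{x_i-x_j=0\mid 1\le i<j\le n\}\cup\{x_i-x_j=s\mid 1\le i\ne j\le n,\ 1\le s\le m\}.$$ For a finite hyperplane arrangement $\mathcal A$ in $\mathbb R^n$, $L(\mathcal A)$ is the poset of nonempty intersections of subfamilies of $\mathcal A$, ordered by reverse inclusion, with minimum $\hat 0=\mathbb R^n$ (the empty intersection). With $\mu$ the Möbius function of $L(\mathcal A)$, the characteristic polynomial is $\chi(\mathcal A,t)=\sum_{X\in L(\mathcal A)}\mu(\hat 0,X)t^{\dim X}$. A simple digraph has no loops and no repeated arcs (both $(i,j)$ and $(j,i)$ may be present). A path cover of $\Gamma$ is a set of vertex-disjoint directed paths of $\Gamma$ covering all vertices, with isolated vertices allowed as paths of length $0$; $\mathrm{path}_k(\Gamma)$ is the number of path covers with exactly $k$ directed paths. ''Factors into integer linear factors'' means factors as a product of polynomials of the form $t-a$ with $a\in\mathbb Z$. *)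

(* Defs.v *)
From HB Require Import structures.
From mathcomp Require Import all_boot all_order all_algebra.
From mathcomp Require Import finmap.
From mathcomp Require Import mathcomp_extra boolp classical_sets functions.
From mathcomp Require Import cardinality fsbigop reals.
From mathcomp Require Import complex.

Set Implicit Arguments.
Unset Strict Implicit.
Unset Printing Implicit Defensive.

Import Order.TTheory GRing.Theory Num.Theory.
Local Open Scope classical_set_scope.
Local Open Scope ring_scope.

Section Mobius.
Variables (T : choiceType) (P : set T) (le : T -> T -> Prop).

(* mu(x, x) = 1 and mu(x, z) = - sum_(x <= y < z) mu(x, y), where k bounds the
   recursion depth. *)
Fixpoint mobius_rec (k : nat) (x z : T) : int :=
  if k is k'.+1 then
    if x == z then 1
    else - \sum_(y \in [set y | [/\ P y, le x y, le y z & y <> z]])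
             mobius_rec k' x y
  else 0.

(* A chain of the finite poset P has at most #|P| elements, so the depth #|P|
   is never exhausted; see mobiusE. *)
Definition mobius (x z : T) : int := mobius_rec #|` fset_set P| x z.

Hypotheses (Pfin : finite_set P)
  (le_trans : forall x y z, le x y -> le y z -> le x z)
  (le_anti : forall x y, le x y -> le y x -> x = y).

Lemma mobius_rec_stable (k l : nat) (x z : T) : P z ->
  (#|` fset_set [set y | P y /\ (le y z \/ y = z)]| <= k)%N ->
  (#|` fset_set [set y | P y /\ (le y z \/ y = z)]| <= l)%N ->
  mobius_rec k x z = mobius_rec l x z.
Proof.
have Dfin (w : T) : finite_set [set y | P y /\ (le y w \/ y = w)].
  by apply: sub_finite_set Pfin => y [].
have Dgt0 (w : T) : P w ->
    (0 < #|` fset_set [set y | P y /\ (le y w \/ y = w)]|)%N.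
  move=> Pw; rewrite cardfs_gt0; apply/fset0Pn; exists w.
  by rewrite in_fset_set //; apply/mem_set; split=> //; right.
elim: k l z => [|k IH] [|l] z Pz; rewrite ?leqn0.
- by [].
- by move=> /eqP h; have := Dgt0 _ Pz; rewrite h.
- by move=> _ /eqP h; have := Dgt0 _ Pz; rewrite h.
move=> hk hl /=; case: eqP => // _; congr (- _); apply: eq_fsbigr => y.
move=> /set_mem [Py _ yz nyz].
have lt_card : (#|` fset_set [set w | P w /\ (le w y \/ w = y)]| <
    #|` fset_set [set w | P w /\ (le w z \/ w = z)]|)%N.
  apply: fproper_ltn_card; rewrite fproperE; apply/andP; split.
    apply/fsubsetP => w; rewrite !in_fset_set // => /set_mem [Pw wy]; apply/mem_set.
    split=> //; left; case: wy => [wy|-> //]; exact: le_trans wy yz.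
  apply/negP => /fsubsetP /(_ z); rewrite !in_fset_set // => zy.
  have /zy /set_mem [_ zy'] :
      z \in [set w | P w /\ (le w z \/ w = z)].
    by apply/mem_set; split=> //; right.
  by apply: nyz; case: zy' => // zy'; exact: le_anti.
by apply: IH => //; rewrite -ltnS; apply: leq_trans lt_card _.
Qed.

Lemma mobiusE (x z : T) : P z ->
  mobius x z =
    if x == z then 1
    else - \sum_(y \in [set y | [/\ P y, le x y, le y z & y <> z]]) mobius x y.
Proof.
have le_card (w : T) :
    (#|` fset_set [set y | P y /\ (le y w \/ y = w)]| <= #|` fset_set P|)%N.
  apply: fsubset_leq_card; apply/fsubsetP => y.
  rewrite !in_fset_set //; last by apply: sub_finite_set Pfin => ? [].
  by move=> /set_mem [Py _]; apply/mem_set.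
move=> Pz; rewrite {1}/mobius (@mobius_rec_stable _ #|` fset_set P|.+1) //.
by rewrite leqW.
Qed.

End Mobius.

Section Arrangements.
Variables (R : realType) (n : nat).
Local Notation V := 'rV[R]_n.

Definition intersection_poset (A : set (set V)) : set (set V) :=
  [set X | X !=set0 /\
           exists2 B : set (set V), B `<=` A & X = \bigcap_(H in B) H].

(* X = p + W for a linear subspace W, and dim X = dim W *)
Definition affine_dim (X : set V) : nat :=
  xget 0%N [set d | exists (p : V) (W : {vspace V}),
                      X = [set x | x - p \in W] /\ d = \dim W].

Lemma affine_dimE (p : V) (W : {vspace V}) :
  affine_dim [set x | x - p \in W] = \dim W.
Proof.
rewrite /affine_dim; case: xgetP => [_ -> [q [U [eX ->]]]|h].
  have pU : p - q \in U.
    have : [set x | x - p \in W] p by rewrite /= subrr mem0v.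
    by rewrite eX.
  congr (\dim _); apply/vspaceP => v.
  have /seteqP[WU UW] := eX.
  have e : (v + p - p \in W) = (v + p - q \in U).
    by apply/idP/idP; [exact: WU | exact: UW].
  transitivity (v + p - q \in U).
    rewrite -addrA; apply/idP/idP => h; first exact: memvD.
    by rewrite -(addrK (p - q) v) memvB.
  by rewrite -e addrK.
by case: (h (\dim W)); exists p, W.
Qed.

(* L(A) is ordered by reverse inclusion, with minimum R^n. *)
Definition char_poly_arr (A : set (set V)) : {poly int} :=
  \sum_(X \in intersection_poset A)
     (mobius (intersection_poset A) (fun X Y => Y `<=` X) setT X
        *: 'X^(affine_dim X)).

Definition diff_hyperplane (i j : 'I_n) (s : nat) : set V :=
  [set x | x 0 i - x 0 j = s%:R].

Definition catalan (m : nat) : set (set V) :=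
  [set H | exists i j : 'I_n, (i < j)%N /\ H = diff_hyperplane i j 0] `|`
  [set H | exists (i j : 'I_n) (s : nat),
             [/\ i != j, (1 <= s <= m)%N & H = diff_hyperplane i j s]].

Definition catalan_del (m : nat) (G : rel 'I_n) : set (set V) :=
  catalan m `\`
  [set H | exists i j : 'I_n, G i j /\ H = diff_hyperplane i j m].

End Arrangements.

Arguments diff_hyperplane R {n} i j s.
Arguments catalan R n m : clear implicits.
Arguments catalan_del R {n} m G.

Section PathCovers.
Variables (n : nat) (G : rel 'I_n).

(* A directed path is encoded by the sequence of its vertices; these are
   distinct, so that there are at most n of them. *)
Definition dipath (p : seq 'I_n) : bool := [&& p != [::], uniq p & sorted G p].

Definition path_cover (C : {set {bseq n of 'I_n}}) : bool :=
  [&& [forall p in C, dipath p],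
      [forall p in C, forall q in C,
         (p != q) ==> ~~ has [in (p : seq 'I_n)] (q : seq 'I_n)]
    & [forall v : 'I_n, exists p in C, v \in (p : seq 'I_n)]].

Definition npath_covers (k : nat) : nat :=
  #|[set C : {set {bseq n of 'I_n}} | path_cover C & #|C| == k]|.

Definition falling_poly (r : nat) : {poly int} := \prod_(i < r) ('X - i%:R).

Definition path_poly : {poly int} :=
  \sum_(1 <= k < n.+1) (npath_covers k)%:R * falling_poly k.-1.

End PathCovers.

Definition splits_int (p : {poly int}) : Prop :=
  exists s : seq int, p = \prod_(a <- s) ('X - a%:P).

(* The complex roots of p, with multiplicity; meaningful up to perm_eq and for
   p <> 0. *)
Definition complex_roots (R : realType) (p : {poly int}) : seq (complex R) :=
  sval (closed_field_poly_normal (map_poly (intr : int -> complex R) p)).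

Definition nonzero_roots (R : realType) (p : {poly int}) : seq (complex R) :=
  [seq z <- complex_roots R p | z != 0].

(* Main.v *)
Require Import Defs.
From mathcomp Require Import finmap boolp classical_sets.
From mathcomp Require Import cardinality fsbigop reals complex.
From mathcomp Require Import all_boot all_order all_algebra zify ring.

(** Everything follows from the identity
      chi(C_n^{m,m}(G), t) = t P(G, t - mn - 1)        ([char_poly_catalan_del])
    and from P(G, -mn - 1) <> 0                        ([path_poly_neg_neq0]).
    The identity turns a factorization of P into one of chi and back, and shows
    that m acts on chi / t by a translation; the second fact says that 0 is a
    simple root of chi, so that the nonzero roots of chi are exactly the
    translates of the roots of P.

    Both sides of the identity are compared at all large integers q.  Whitney's
    formula ([whitney_formula]) writes chi as an alternating sum over the
    consistent sets of equations x_i - x_j = s.  Such a set is solved by one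
    formula valid over every commutative ring, or else it implies N = 0 for some
    positive integer N ([solved_form]); hence for large q a flat of dimension d
    has q^d points over Z/q, and an inconsistent set has none.  By
    inclusion-exclusion, chi(q) is the number of points of (Z/q)^n that satisfy
    no equation of the arrangement ([sum_edge_solutions]).  These points are the
    placements of n labelled vertices on a cycle of q cells, any two of them at
    least m cells apart, and exactly m apart only along an arc of G.

    Let each vertex occupy the m cells that start at its position.  Every
    placement leaves q - mn cells free, so that counting pairs (placement, free
    cell) and rotating the free cell to the last position replaces the cycle by
    a segment of q - 1 cells with q - mn - 1 free ones.  The free cells cut the
    segment into q - mn slots; the vertices in one slot form a path of G or the
    slot is empty.  A placement is thus a path cover C of G with an injection
    of C into the slots, and their number is
      sum_C (q - mn)^{falling #|C|} = (q - mn) P(G, q - mn - 1)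
    ([card_linear_config], [cover_sum_path_poly]), which yields
    chi(q) = q P(G, q - mn - 1) ([card_cyclic_config]).

    The nonvanishing is a reciprocity phenomenon: the recursion that counts
    placements one vertex at a time can be solved for its values at negative
    integers, and up to a global sign it then only adds nonnegative terms
    ([signed_cover_sum_ge0]). *)

Set Implicit Arguments.
Unset Strict Implicit.
Unset Printing Implicit Defensive.

Import Order.TTheory GRing.Theory Num.Theory.
Local Open Scope ring_scope.

(** * Path covers distributed over slots *)

Section CoverSums.
Variables (n : nat) (G : rel 'I_n).
Implicit Types (S : {set 'I_n}) (a : pred 'I_n) (z : int) (u : 'I_n).

(** The falling factorial over the integers: negative arguments are needed for
    the reciprocity argument. *)
Definition falling (r : nat) z : int := \prod_(i < r) (z - i%:R).

Lemma falling_polyE r z : (falling_poly r).[z] = falling r z.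
Proof.
rewrite /falling_poly horner_prod; apply: eq_bigr => i _.
by rewrite hornerD hornerN hornerX -polyC_natr hornerC.
Qed.

Lemma fallingS r z : falling r.+1 z = falling r z * (z - r%:R).
Proof. by rewrite /falling big_ord_recr. Qed.

Lemma fallingSl r z : falling r.+1 z = z * falling r (z - 1).
Proof.
rewrite /falling big_ord_recl subr0; congr (_ * _); apply: eq_bigr => i _.
by rewrite lift0 /= -addn1 natrD; ring.
Qed.

Lemma falling_succ r z :
  falling r (z + 1) = falling r z + r%:R * falling r.-1 z.
Proof.
case: r => [|r]; first by rewrite /falling !big_ord0 mul0r addr0.
by rewrite fallingSl addrK fallingS /= -natr1; ring.
Qed.

Lemma falling0 r : falling r 0 = (r == 0)%:R.
Proof. by case: r => [|r]; rewrite /falling ?big_ord0 // big_ord_recl !mul0r. Qed.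

(** [path_cover] relative to a set of vertices, so that a path can be removed
    from a cover. *)
Definition covers S (C : {set {bseq n of 'I_n}}) : bool :=
  [&& [forall p in C, dipath G p],
      [forall p in C, forall q in C,
         (p != q) ==> ~~ has [in (p : seq 'I_n)] (q : seq 'I_n)]
    & [forall v, (v \in S) == [exists p in C, v \in (p : seq 'I_n)]]].

(** For a natural number z, this counts the path covers of the vertex set S
    together with an injective assignment of a slot, among z, to each path.  As
    a polynomial in z it equals z P(G, z - 1) when S is the whole vertex set,
    which is nonempty. *)
Definition cover_sum S z : int := \sum_(C | covers S C) falling #|C| z.

Lemma coversP S (C : {set {bseq n of 'I_n}}) :
  reflect [/\ forall p, p \in C -> dipath G p,
              forall p q v, p \in C -> q \in C -> v \in (p : seq _) ->
                v \in (q : seq _) -> p = q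
            & forall v, v \in S <-> exists2 p, p \in C & v \in (p : seq _)]
          (covers S C).
Proof.
apply: (iffP and3P) => [[/forall_inP dC /forall_inP tC /forallP cC]|[dC tC cC]].
  split=> // [p q v pC qC vp vq|v]; last first.
    by rewrite (eqP (cC v)); split=> /exists_inP.
  apply/eqP; apply: contraTT vp => neq.
  have /forall_inP /(_ q qC) /implyP /(_ neq) := tC p pC.
  by rewrite -all_predC => /allP /(_ v vq).
split; first exact/forall_inP.
  apply/forall_inP => p pC; apply/forall_inP => q qC; apply/implyP => /eqP neq.
  by apply/hasP => -[v vq vp]; apply: neq; apply: tC vp vq.
by apply/forallP => v; apply/eqP; apply/idP/exists_inP => /cC.
Qed.

Lemma covers_path_cover C : covers setT C = path_cover G C.
Proof.
rewrite /covers /path_cover; do 2 congr (_ && _).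
by apply: eq_forallb => v; rewrite in_setT.
Qed.

Lemma dipath_neq0 (p : seq 'I_n) : dipath G p -> p != [::].
Proof. by case/and3P. Qed.

Lemma covers0 C : covers set0 C = (C == set0).
Proof.
apply/coversP/eqP => [[dC tC cC]|->].
  apply/setP => p; rewrite inE; apply/negP => pC.
  move: (dipath_neq0 (dC p pC)); case ep: (p : seq _) => [//|v s] _.
  suff : v \in set0 by rewrite inE.
  by apply/cC; exists p => //; rewrite ep mem_head.
split=> [p|p q v|v]; rewrite ?inE //.
by split=> // -[p]; rewrite inE.
Qed.

Lemma cover_sum_set0 z : cover_sum set0 z = 1.
Proof.
rewrite /cover_sum (eq_bigl (pred1 set0)) ?big_pred1_eq ?cards0 ?/falling ?big_ord0 //.
exact: covers0.
Qed.

Lemma cover_sum0 S : cover_sum S 0 = (S == set0)%:R.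
Proof.
have [->|S0] := eqVneq S set0; first by rewrite cover_sum_set0.
rewrite /cover_sum big1 // => C /coversP[_ _ cC]; rewrite falling0 cards_eq0.
case: eqP => // C0; case/set0Pn: S0 => v /cC [p]; by rewrite C0 inE.
Qed.

(** The paths, possibly empty, that can fill one slot with vertices of S when the
    first vertex has to satisfy [a]: during the recursion [a] is the set of
    successors of the vertex placed just before.  The number k bounds the
    length; k = #|S| loses nothing, see [mem_blocks]. *)
Fixpoint blocks_rec (k : nat) S a : seq (seq 'I_n) :=
  [::] :: if k is k'.+1 then
    [seq u :: p | u <- enum [set u in S | a u],
                  p <- blocks_rec k' (S :\ u) (G u)]
  else [::].

Definition blocks S a := blocks_rec #|S| S a.

(** Counts the fillings of z + 1 slots by the vertices of S, the path in the first
    slot being constrained by [a] and those in the other slots arbitrary. *)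
Definition block_sum S a z : int :=
  \sum_(p <- blocks S a) cover_sum (S :\: [set v in p]) z.

Lemma mem_blocks_rec k S a p : (p \in blocks_rec k S a) =
  [&& (size p <= k)%N, uniq p, all [in S] p
    & if p is u :: p' then a u && path G u p' else true].
Proof.
elim: k S a p => [|k IH] S a [|u p] //=.
rewrite inE /= ltnS; apply/allpairsPdep/idP.
  move=> [v [q [+ + [-> ->]]]]; rewrite mem_enum inE => /andP[vS av].
  rewrite IH => /and4P[-> -> qS hq]; rewrite vS av /=.
  rewrite andbT; apply/and3P; split.
  - by apply/negP => /(allP qS); rewrite !inE eqxx.
  - by apply/allP => w /(allP qS); rewrite !inE => /andP[].
  - by case: (q) hq.
move=> /and4P[sp /andP[up Up] /andP[uS pS] /andP[au pu]].
exists u, p; split=> //; first by rewrite mem_enum inE uS.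
rewrite IH sp Up /=; apply/andP; split; last by case: (p) pu.
apply/allP => w wp; rewrite !inE (allP pS w wp) andbT.
by apply: contraNneq up => <-.
Qed.

Lemma mem_blocks S a p : (p \in blocks S a) =
  [&& uniq p, all [in S] p
    & if p is u :: p' then a u && path G u p' else true].
Proof.
rewrite /blocks mem_blocks_rec; apply: andb_idl => /and3P[Up pS _].
by rewrite cardE uniq_leq_size // => v /(allP pS); rewrite mem_enum.
Qed.

Lemma blocks_uniq S a : uniq (blocks S a).
Proof.
rewrite /blocks; move: #|S| => k; elim: k S a => [|k IH] S a //=.
apply/andP; split; first by apply/allpairsPdep => -[u [p []]].
apply: allpairs_uniq_dep; first exact: enum_uniq.
  by move=> u _; apply: IH.
by move=> /= [u p] [v q] _ _ /= [-> ->].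
Qed.

(** The first slot is empty, or has a first vertex u, after which the rest of the
    slot must start with a successor of u. *)
Lemma block_sum_rec S a z :
  block_sum S a z = cover_sum S z + \sum_(u in S | a u) block_sum (S :\ u) (G u) z.
Proof.
rewrite /block_sum /blocks.
have eqS0 : S :\: [set v in [::]] = S by apply/setP => v; rewrite !inE.
case eqk: #|S| => [|k] /=; rewrite big_cons eqS0; congr (_ + _).
  rewrite big_nil big_pred0 // => u; have /cards0_eq -> := eqk.
  by rewrite inE.
rewrite big_allpairs_dep /= big_enum_cond /=.
rewrite [RHS](eq_bigl [in [set u in S | a u]]); last by move=> u; rewrite inE.
rewrite big_mkcondr /=; apply: eq_bigr => u; rewrite inE => /andP[uS _].
have -> : #|S :\ u| = k by move: eqk; rewrite (cardsD1 u) uS => -[].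
apply: eq_bigr => p _; congr (cover_sum _ z).
by apply/setP => v; rewrite !inE negb_or andbCA andbA.
Qed.

(** With [coversD] below: adding and removing p is a bijection between the path
    covers of S minus p and those of S that contain p. *)
Lemma coversU (p : {bseq n of 'I_n}) S C :
    dipath G p -> all [in S] p -> covers (S :\: [set v in (p : seq _)]) C ->
  p \notin C /\ covers S (p |: C).
Proof.
move=> dp pS /coversP[dC tC cC].
have disj q v : q \in C -> v \in (q : seq _) -> v \notin (p : seq _).
  move=> qC vq; have /cC : exists2 p, p \in C & v \in (p : seq _) by exists q.
  by rewrite !inE => /andP[].
split.
  apply/negP => pC; move: (dipath_neq0 dp).
  case ep: (p : seq _) => [//|v s] _.
  by have := disj p v pC; rewrite ep mem_head => /(_ isT).
apply/coversP; split.
- by move=> q /setU1P[->|/dC].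
- move=> q r v /setU1P[->|qC] /setU1P[->|rC] // vq vr.
  + by have := disj r v rC vr; rewrite vq.
  + by have := disj q v qC vq; rewrite vr.
  + exact: tC vq vr.
- move=> v; split=> [vS|[q /setU1P[->|qC] vq]].
  + have [vp|vp] := boolP (v \in (p : seq _)); first by exists p; rewrite ?setU11.
    have /cC[q qC vq] : v \in S :\: [set v in (p : seq _)] by rewrite !inE vp.
    by exists q; rewrite // setU1r.
  + exact: (allP pS).
  + have /cC : exists2 p, p \in C & v \in (p : seq _) by exists q.
    by rewrite inE => /andP[].
Qed.

Lemma coversD (p : {bseq n of 'I_n}) S C : covers S C -> p \in C ->
  [/\ dipath G p, all [in S] p & covers (S :\: [set v in (p : seq _)]) (C :\ p)].
Proof.
move=> /coversP[dC tC cC] pC; split; first exact: dC.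
  by apply/allP => v vp; apply/cC; exists p.
apply/coversP; split.
- by move=> q /setD1P[_ /dC].
- by move=> q r v /setD1P[_ qC] /setD1P[_ rC]; apply: tC.
- move=> v; split=> [|[q /setD1P[neq qC] vq]].
    rewrite !inE => /andP[vp /cC[q qC vq]]; exists q => //.
    by rewrite !inE qC andbT; apply: contraNneq vp => <-.
  rewrite !inE; apply/andP; split; last by apply/cC; exists q.
  by apply: contraNN neq => vp; rewrite (tC _ _ _ qC pC vq vp).
Qed.

(** With z + 1 slots, one may single out the first one: no condition bears on what
    it contains.  Since this is needed at all integers z, the proof goes through
    (z+1)^{falling k} = z^{falling k} + k z^{falling k-1}; the factor k = #|C|
    is the choice of the path p of C that fills the first slot. *)
Lemma cover_sum_succ S z : cover_sum S (z + 1) = block_sum S predT z.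
Proof.
pose ok (p : {bseq n of 'I_n}) := dipath G p && all [in S] p.
have blocksE : perm_eq (blocks S predT)
    ([::] :: [seq val p | p : {bseq n of 'I_n} in ok]).
  apply: uniq_perm; first exact: blocks_uniq.
    rewrite /= map_inj_uniq ?enum_uniq ?andbT; last exact: val_inj.
    by apply/mapP => -[p]; rewrite mem_enum => /andP[/dipath_neq0 + _] e; rewrite -e.
  move=> p; rewrite mem_blocks inE; apply/idP/orP.
    move=> /and3P[Up pS hp]; have [->|p0] := eqVneq p [::]; [by left|right].
    have sp : (size p <= n)%N.
      rewrite -[n in leqRHS]card_ord cardE uniq_leq_size // => v.
      by rewrite mem_enum.
    apply/mapP; exists (Bseq sp) => //; rewrite mem_enum unfold_in /ok /= pS andbT.
    by apply/and3P; split=> //; case: (p) hp.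
  move=> [/eqP-> //|/mapP[q]]; rewrite mem_enum => /andP[/and3P[q0 Uq sq] qS] ->.
  by apply/and3P; split=> //; case: (val q) sq.
rewrite /block_sum (perm_big _ blocksE) /= big_cons.
have -> : S :\: [set v in [::]] = S by apply/setP => v; rewrite !inE.
rewrite /cover_sum (eq_bigr _ (fun C _ => falling_succ _ _)) big_split /=.
congr (_ + _).
rewrite big_map big_enum /=.
under eq_bigr => C _ do rewrite mulr_natl -sumr_const.
rewrite (exchange_big_dep [in ok]) /=; last first.
  by move=> C p cC pC; have [dp pS _] := coversD cC pC; rewrite unfold_in /ok dp.
apply: eq_bigr => p /andP[dp pS].
rewrite (reindex_onto (fun C => p |: C) (fun C => C :\ p)) /=; last first.
  by move=> C /andP[_ pC]; rewrite setD1K.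
apply: eq_big => [C|C].
  apply/idP/idP => [/andP[/andP[cC pC] /eqP eC]|cC].
    by have [_ _] := coversD cC pC; rewrite eC.
  have [pC cpC] := coversU dp pS cC; rewrite cpC setU11 /=.
  by rewrite setU1K.
move=> /andP[/andP[_ _] /eqP eC]; rewrite cardsU1 -{1 2}eC !inE eqxx /=.
by rewrite eC.
Qed.

End CoverSums.

(** * Reciprocity: values at negative integers *)

Section Positivity.
Variables (n : nat) (G : rel 'I_n).
Implicit Types (S : {set 'I_n}) (a : pred 'I_n) (y : nat) (u : 'I_n).

(** The sign (-1)^#|S| is the one under which the recursions have no sign. *)
Definition signed_cover_sum S y : int := (-1) ^+ #|S| * cover_sum G S (- y%:R).

Definition signed_block_sum S a y : int :=
  (-1) ^+ #|S| * block_sum G S a (- y%:R).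

Lemma signed_block_sum_rec S a y : signed_block_sum S a y =
  signed_cover_sum S y - \sum_(u in S | a u) signed_block_sum (S :\ u) (G u) y.
Proof.
rewrite /signed_block_sum block_sum_rec mulrDr -sumrN.
congr (_ + _); rewrite mulr_sumr; apply: eq_bigr => u /andP[uS _].
by rewrite (cardsD1 u) uS /= exprS mulN1r mulNr.
Qed.

Lemma signed_block_sumT S y : signed_block_sum S predT y.+1 = signed_cover_sum S y.
Proof.
rewrite /signed_block_sum -cover_sum_succ /signed_cover_sum.
congr (_ * cover_sum _ _ _).
by rewrite -natr1; ring.
Qed.

Lemma signed_cover_sumS S y : signed_cover_sum S y.+1 =
  signed_cover_sum S y + \sum_(u in S) signed_block_sum (S :\ u) (G u) y.+1.
Proof.
have := signed_block_sum_rec S predT y.+1; rewrite signed_block_sumT => ->.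
by rewrite (eq_bigl [in S]) ?subrK // => u; rewrite andbT.
Qed.

(** Here the complement of [a] appears: subtracting the vertices allowed by [a]
    from all the vertices of S leaves the forbidden ones, with a plus sign. *)
Lemma signed_block_sumS S a y : signed_block_sum S a y.+1 =
  signed_cover_sum S y +
  \sum_(u in S | ~~ a u) signed_block_sum (S :\ u) (G u) y.+1.
Proof.
rewrite signed_block_sum_rec signed_cover_sumS (bigID a) /=.
by rewrite addrA addrAC addrK.
Qed.

(** By induction on #|S| and then on y, as [signed_cover_sumS] and
    [signed_block_sumS] only add terms of the same kind.  The value is positive as
    soon as there is room to remove one vertex of S at each decrement of y. *)
Lemma signed_cover_sum_ge0 S :
  [/\ forall y, 0 <= signed_cover_sum S y,
      forall y, (#|S| <= y)%N -> 0 < signed_cover_sum S y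
    & forall a y, signed_cover_sum S y <= signed_block_sum S a y.+1].
Proof.
have [k] := ubnP #|S|; elim: k S => // k IH S; rewrite ltnS => leSk.
have IHu u : u \in S -> forall y,
    signed_cover_sum (S :\ u) y <= signed_block_sum (S :\ u) (G u) y.+1 /\
    0 <= signed_block_sum (S :\ u) (G u) y.+1.
  move=> uS y; have [|h0 _ h] := IH (S :\ u).
    by move: leSk; rewrite (cardsD1 u) uS.
  by split=> //; apply: le_trans (h0 y) (h _ _).
have ge0 y : 0 <= signed_cover_sum S y.
  elim: y => [|y IHy].
    rewrite /signed_cover_sum oppr0 cover_sum0.
    by case: eqP => [->|_]; rewrite ?mulr0 // cards0.
  rewrite signed_cover_sumS addr_ge0 // sumr_ge0 // => u uS.
  by have [] := IHu u uS y.
split=> // [y leSy|a y]; last first.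
  rewrite signed_block_sumS lerDl sumr_ge0 // => u /andP[uS _].
  by have [] := IHu u uS y.
have [S0|[u uS]] := set_0Vmem S.
  by rewrite /signed_cover_sum S0 cards0 cover_sum_set0.
case: y leSy => [|y] leSy; first by move: leSy; rewrite (cardsD1 u) uS.
rewrite signed_cover_sumS (bigD1 u) //= ltr_wpDl // ltr_pwDl //; last first.
  by apply: sumr_ge0 => v /andP[vS _]; have [] := IHu v vS y.
have [|_ h _] := IH (S :\ u); first by move: leSk; rewrite (cardsD1 u) uS.
have [h' _] := IHu u uS y; apply: lt_le_trans h'; apply: h.
by move: leSy; rewrite (cardsD1 u) uS.
Qed.

Lemma cover_sum_neg_neq0 S y : (#|S| <= y)%N -> cover_sum G S (- y%:R) != 0.
Proof.
move=> leSy; have [_ /(_ y leSy)] := signed_cover_sum_ge0 S.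
by rewrite /signed_cover_sum; case: eqP => // ->; rewrite mulr0 ltxx.
Qed.

Lemma card_path_cover C : path_cover G C -> (0 < n)%N -> (0 < #|C| < n.+1)%N.
Proof.
rewrite -covers_path_cover => /coversP[dC tC cC] n0.
have [p pC _] : exists2 p, p \in C & Ordinal n0 \in (p : seq _) by apply/cC.
apply/andP; split; first by apply/card_gt0P; exists p.
rewrite ltnS -[n in leqRHS]card_ord.
rewrite -(@card_in_imset _ _ (fun q : {bseq n of 'I_n} => head (Ordinal n0) q)).
  exact: max_card.
move=> q r qC rC; move: (dipath_neq0 (dC q qC)) (dipath_neq0 (dC r rC)).
move: (tC q r (head (Ordinal n0) q) qC rC).
case: (q : seq _) => [//|v s]; case: (r : seq _) => [//|w t] /= + _ _ evw.
by rewrite -evw !mem_head; apply.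
Qed.

(** P(G, z) is defined with k - 1 factors in the term of path covers with k paths;
    the missing factor is z, because z^{falling k} = z (z-1)^{falling k-1}. *)
Lemma cover_sum_path_poly z : (0 < n)%N ->
  cover_sum G setT z = z * (path_poly G).[z - 1].
Proof.
move=> n0; rewrite /path_poly horner_sum mulr_sumr.
rewrite /cover_sum (eq_bigl (path_cover G)); last exact: covers_path_cover.
transitivity (\sum_(C | path_cover G C) \sum_(1 <= k < n.+1 | k == #|C|)
    z * falling k.-1 (z - 1)).
  apply: eq_bigr => C /card_path_cover /(_ n0) /andP[C0 Cn].
  rewrite big_nat1_eq C0 Cn /=.
  by rewrite -{1}(prednK C0) fallingSl.
rewrite (exchange_big_dep xpredT) //=; apply: eq_bigr => k _.
rewrite hornerM -polyC_natr hornerC falling_polyE sumr_const -[LHS]mulr_natl.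
rewrite [RHS]mulrCA; congr (_%:R * _); apply: eq_card => C.
by rewrite !inE unfold_in eq_sym.
Qed.

End Positivity.

(** * Placements on a segment *)

Section Configurations.
Variables (n : nat) (G : rel 'I_n) (m q : nat).
Hypothesis m_gt0 : (0 < m)%N.
Local Notation config := {ffun 'I_n -> 'I_q.+2}.
Implicit Types (S : {set 'I_n}) (a : pred 'I_n) (M : nat) (x y : config).

(** Vertex i lies above vertex j: their blocks of m cells do not meet, and they
    touch only if (i, j) is an arc.  The paths of G are read downwards, since an
    arc (i, j) allows x_i - x_j = m. *)
Definition above x (i j : 'I_n) : bool :=
  (x j + m < x i)%N || ((x i == x j + m :> nat)%N && G i j).

(** Placements of the vertices of S on the cells 0 .. M-1, such that a vertex whose
    block reaches the top cell satisfies [a].  The other coordinates are set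
    to 0, so that one type of functions serves for all S and M. *)
Definition linear_config S M a x : bool :=
  [forall i, if i \in S then (x i + m <= M)%N && ((x i + m == M)%N ==> a i)
             else x i == ord0]
  && [forall i in S, forall j in S, (i != j) ==> above x i j || above x j i].

Lemma linear_configP S M a x : reflect
  [/\ forall i, i \in S -> (x i + m <= M)%N,
      forall i, i \in S -> (x i + m)%N = M -> a i,
      forall i, i \notin S -> x i = ord0
    & forall i j, i \in S -> j \in S -> i != j -> above x i j || above x j i]
  (linear_config S M a x).
Proof.
apply: (iffP andP) => [[/forallP h /forall_inP h']|[h1 h2 h3 h4]].
  split=> [i iS|i iS e|i iS|i j iS jS ij].
  - by have := h i; rewrite iS => /andP[].
  - by have := h i; rewrite iS e eqxx => /andP[].
  - by have := h i; rewrite (negbTE iS) => /eqP.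
  - by have /forall_inP/(_ _ jS)/implyP := h' i iS; apply.
split.
  apply/forallP => i; case: ifPn => [iS|/h3-> //].
  by rewrite h1 //=; apply/implyP => /eqP; apply: h2.
apply/forall_inP => i iS; apply/forall_inP => j jS; apply/implyP => ij.
exact: h4.
Qed.

Lemma in_linear_config S M a x : (x \in linear_config S M a) = linear_config S M a x.
Proof. by []. Qed.

Definition place (u : 'I_n) (c : 'I_q.+2) x : config :=
  [ffun i => if i == u then c else x i].

(** Removing the topmost vertex u leaves a placement below its block, where the
    topmost vertex may touch u only if it is a successor of u. *)
Lemma card_linear_config_top S M a u :
    u \in S -> a u -> (m <= M.+1)%N -> (M < q.+2)%N ->
  #|[pred x | linear_config S M.+1 a x & (x u + m == M.+1)%N]| =
  #|linear_config (S :\ u) (M.+1 - m) (G u)|.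
Proof.
move=> uS au mM Mq; pose t := @inord q.+1 (M.+1 - m).
have tE : t = (M.+1 - m)%N :> nat by rewrite inordK //; lia.
rewrite -!sum1_card (reindex_onto (place u t) (place u ord0)) /=; last first.
  move=> x /andP[_ /eqP xu]; apply/ffunP => i; rewrite !ffunE.
  by case: eqP => // ->; apply: val_inj; rewrite /= tE -xu addnK.
apply: eq_bigl => y; rewrite in_linear_config !inE.
have pu : place u t y u = t by rewrite ffunE eqxx.
have pn i : i != u -> place u t y i = y i by rewrite ffunE => /negbTE->.
apply/idP/linear_configP.
  move=> /andP[/andP[/linear_configP[h1 h2 h3 h4] _] /eqP yE].
  have yu : y u = ord0 by rewrite -yE ffunE eqxx.
  have hu i : i \in S :\ u ->
      (y i + m < t)%N || ((t == y i + m :> nat)%N && G u i).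
    move=> /setD1P[iu iS]; have := h4 u i uS iS; rewrite eq_sym => /(_ iu).
    rewrite /above pu pn //; case/orP=> //; have := h1 i iS.
    rewrite pn // tE; move: mM m_gt0; lia.
  split=> [i /hu|i iS e|i|i j /setD1P[iu iS] /setD1P[ju jS] ij].
  - by rewrite tE; lia.
  - by have := hu i iS; rewrite tE; lia.
  - rewrite !inE negb_and negbK; have [->|iu] //= := eqVneq i u.
    by move=> /h3; rewrite pn.
  - by have := h4 i j iS jS ij; rewrite /above !pn.
move=> [h1 h2 h3 h4]; rewrite pu tE subnK // eqxx andbT.
apply/andP; split; last first.
  apply/eqP/ffunP => i; rewrite !ffunE; case: eqP => // ->.
  by rewrite h3 // !inE eqxx.
have inD i : i \in S -> i != u -> i \in S :\ u by move=> ? ?; apply/setD1P.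
have hu i : i \in S -> i != u -> above (place u t y) u i.
  move=> iS iu; rewrite /above pu pn // tE.
  have := h1 i (inD i iS iu); rewrite leq_eqVlt => /orP[/eqP e|->//].
  by rewrite h2 ?inD // -e eqxx orbT.
apply/linear_configP; split=> [i iS|i iS|i iS|i j iS jS ij].
- have [->|iu] := eqVneq i u; first by rewrite pu tE subnK.
  by rewrite pn //; have := h1 i (inD i iS iu); lia.
- have [-> //|iu] := eqVneq i u.
  by rewrite pn //; have := h1 i (inD i iS iu); lia.
- have iu : i != u by apply: contraNneq iS => ->.
  by rewrite pn // h3 // !inE negb_and iS orbT.
- have [eiu|iu] := eqVneq i u; first by rewrite eiu hu // -eiu eq_sym.
  have [->|ju] := eqVneq j u; first by rewrite hu ?orbT.
  by rewrite /above !pn //; apply: h4 => //; apply: inD.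
Qed.

(** The top cell is either free, or covered by the block of exactly one vertex. *)
Lemma card_linear_configS S M a : (M < q.+2)%N ->
  #|linear_config S M.+1 a| = (#|linear_config S M predT| +
    \sum_(u in S | a u && (m <= M.+1)) #|linear_config (S :\ u) (M.+1 - m) (G u)|)%N.
Proof.
move=> Mq.
under eq_bigr => u /and3P[uS au mM] do
  rewrite -(card_linear_config_top uS au mM Mq) -sum1_card big_mkcond /=.
rewrite exchange_big /= -!sum1_card [LHS]big_mkcond /=.
rewrite [X in (X + _)%N]big_mkcond -big_split; apply: eq_bigr => x _ /=.
rewrite !in_linear_config.
have [/exists_inP[u uS /eqP xu]|/exists_inPn ntop] :=
  boolP [exists u in S, (x u + m == M.+1)%N].
  have -> : linear_config S M predT x = false.
    by apply/linear_configP => -[/(_ u uS)]; rewrite xu ltnn.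
  rewrite add0n -big_mkcondr /=.
  case: (boolP (linear_config S M.+1 a x)) => hx; last first.
    by rewrite big1 // => v; rewrite inE (negbTE hx) andbF.
  have /linear_configP[h1 h2 _ h4] := hx.
  rewrite (big_pred1 u) // => v; rewrite !inE.
  apply/idP/eqP => [/and3P[/and3P[vS _ _] _ /eqP xv]|->].
    apply/eqP/negPn/negP => vu.
    by have := h4 u v uS vS; rewrite eq_sym vu /above => /(_ isT); lia.
  by rewrite uS hx xu (h2 u uS) // eqxx -xu leq_addl.
rewrite [X in (_ + X)%N]big1 => [|u /and3P[uS _ _]]; last first.
  by rewrite inE (negbTE (ntop u uS)) andbF.
rewrite addn0; congr (if _ then _ else _).
apply/linear_configP/linear_configP => -[h1 h2 h3 h4]; split=> // i iS.
- by have := h1 i iS; have := ntop i iS; lia.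
- by have := h1 i iS; lia.
- by have := ntop i iS; lia.
Qed.

(** The M - m #|S| free cells separate one more slot than their number, and the
    topmost slot is the one constrained by [a].  In these terms, the recursion of
    [card_linear_configS] is the conjunction of [block_sum_rec] and [cover_sum_succ]. *)
Lemma card_linear_config S M a : (M <= q.+2)%N ->
  #|linear_config S M a|%:R =
    if (m * #|S| <= M)%N then block_sum G S a (M - m * #|S|)%N%:R else 0 :> int.
Proof.
have [k] := ubnP M; elim: k S M a => // k IH S [|M] a; rewrite ltnS => lek leMq.
  rewrite leqn0 muln_eq0 gtn_eqF //= cards_eq0.
  have [->|/set0Pn[u uS]] := eqVneq S set0.
    rewrite cards0 muln0 subn0 block_sum_rec cover_sum_set0 big_pred0 ?addr0.
      rewrite (@eq_card1 _ [ffun=> ord0]) // => x; rewrite in_linear_config ?inE.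
      apply/linear_configP/eqP => [[_ _ h _]|->].
        by apply/ffunP => i; rewrite ffunE h // inE.
      by split=> [i|i|i|i j]; rewrite ?inE // ffunE.
    by move=> u; rewrite inE.
  rewrite eq_card0 // => x; rewrite in_linear_config ?inE.
  by apply/linear_configP => -[/(_ u uS)]; move: m_gt0; lia.
rewrite card_linear_configS // natrD natr_sum IH //; last exact: ltnW.
have IHu u : u \in S -> (m <= M.+1)%N ->
    #|linear_config (S :\ u) (M.+1 - m) (G u)|%:R =
    if (m * #|S| <= M.+1)%N then
      block_sum G (S :\ u) (G u) (M.+1 - m * #|S|)%N%:R else 0 :> int.
  move=> uS mM; rewrite IH; [|lia|lia].
  rewrite (cardsD1 u S) uS mulnDr muln1 subnDA; congr (if _ then _ else _).
  by rewrite leq_subRL // .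
under eq_bigr => u /and3P[uS _ mM] do rewrite IHu //.
have [le1|gt1] := leqP (m * #|S|) M.+1; last first.
  rewrite leqNgt (ltn_trans _ gt1) // add0r big1 //.
rewrite [RHS]block_sum_rec; congr (_ + _); last first.
  apply: eq_bigl => u; case uS: (u \in S) => //=.
  rewrite (_ : (m <= _)%N) ?andbT //; apply: leq_trans le1.
  by rewrite leq_pmulr // (cardsD1 u) uS.
case: leqP => [le|lt].
  by rewrite -cover_sum_succ subSn // -natr1.
have e : (m * #|S| = M.+1)%N by lia.
rewrite e subnn cover_sum0; case: eqP => // S0.
by move: e; rewrite S0 cards0 muln0.
Qed.

End Configurations.

(** * Placements on a cycle *)

Section CyclicConfigurations.
Variables (n : nat) (G : rel 'I_n) (m q : nat).
Hypotheses (m_gt0 : (0 < m)%N) (mn_q : (m * n < q.+2)%N).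
Local Notation Zq := 'I_q.+2.
Local Notation config := {ffun 'I_n -> Zq}.
Implicit Types x : config.

Definition cyclic_config x : bool :=
  [forall i, forall j, forall s : 'I_m.+1,
     (i != j) && (x i - x j == (s : nat)%:R) ==> (s == m :> nat) && G i j].

Lemma cyclic_configP x : reflect
  (forall i j s, (s <= m)%N -> i != j -> x i - x j = s%:R -> s = m /\ G i j)
  (cyclic_config x).
Proof.
apply: (iffP forallP) => [h i j s sm ij e|h i].
  have /forallP/(_ j)/forallP/(_ (Ordinal (sm : s < m.+1)%N)) := h i.
  by rewrite ij e eqxx => /andP[/eqP].
apply/forallP => j; apply/forallP => s; apply/implyP => /andP[ij /eqP e].
by have [-> ->] := h i j s (ltn_ord s) ij e; rewrite eqxx.
Qed.

Definition free_cells x : {set Zq} :=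
  [set c | [forall i, forall t : 'I_m, c != x i + (t : nat)%:R]].

Lemma m_lt_q (i : 'I_n) : (m < q.+2)%N.
Proof.
apply: leq_ltn_trans mn_q; rewrite leq_pmulr //.
exact: leq_ltn_trans (ltn_ord i).
Qed.

Lemma natrZq k : (k%:R : Zq) = (k %% q.+2)%N :> nat.
Proof. by rewrite (@val_Zp_nat q.+2). Qed.

(** Blocks are disjoint: a common cell would give x_i - x_j = s with s < m. *)
Lemma card_free_cells x : cyclic_config x -> #|free_cells x| = (q.+2 - m * n)%N.
Proof.
move=> /cyclic_configP cx.
pose cell (it : 'I_n * 'I_m) : Zq := x it.1 + (it.2 : nat)%:R.
have cell_inj : injective cell.
  suff le_inj i j (s t : 'I_m) : (s <= t)%N -> cell (i, s) = cell (j, t) ->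
      (i, s) = (j, t).
    move=> [i s] [j t] e; case: (leqP s t) => [st|/ltnW ts]; first exact: le_inj.
    by apply/esym; apply: le_inj.
  move=> st; rewrite /cell /= => e.
  have d : x i - x j = (t - s)%N%:R.
    by apply/eqP; rewrite natrB // subr_eq addrAC eq_sym subr_eq addrC e.
  have tm : (t - s < m)%N by have := ltn_ord t; lia.
  have [eij|neq] := eqVneq i j; last first.
    by have [ets _] := cx i j (t - s)%N (ltnW tm) neq d; move: tm; rewrite ets ltnn.
  congr (_, _) => //; apply: val_inj => /=.
  move: d; rewrite eij subrr => /(congr1 val) /=.
  rewrite natrZq modn_small; first lia.
  exact: ltn_trans tm (m_lt_q i).
have -> : free_cells x = ~: [set cell it | it in predT].
  apply/setP => c; rewrite !inE; apply/forallP/negP => [h /imsetP[[i t] _ e]|h i].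
    by have /forallP/(_ t) := h i; rewrite e eqxx.
  apply/forallP => t; apply/eqP => e; apply: h; apply/imsetP.
  by exists (i, t).
rewrite cardsCs finset.setCK card_imset // card_ord; congr (_ - _)%N.
by rewrite card_prod !card_ord mulnC.
Qed.

(** When the last cell, -1, is free, no block crosses it, and differences on the
    cycle are differences of representatives. *)
Lemma cyclic_config_linear x :
  cyclic_config x && (-1 \in free_cells x) = linear_config G m finset.setT q.+1 predT x.
Proof.
have freeE : (-1 \in free_cells x) = [forall i, (x i + m < q.+2)%N].
  rewrite inE; apply/forallP/forallP => h i.
    rewrite ltnNge; apply/negP => hi; have xi := ltn_ord (x i).
    have tm : (q.+1 - x i < m)%N by lia.
    have /forallP/(_ (Ordinal tm))/eqP := h i; apply; apply: val_inj => /=.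
    rewrite natrZq modnDmr subnKC; last lia.
    by rewrite !modn_small //; lia.
  apply/forallP => t; apply/eqP => /(congr1 val) /=.
  have tm := ltn_ord t; have hi := h i.
  rewrite natrZq modnDmr [in RHS]modn_small; last lia.
  by rewrite [(1 %% _)%N]modn_small // subn1 /= modn_small //; lia.
rewrite freeE; have [h|h] := boolP [forall i, (x i + m < q.+2)%N]; last first.
  rewrite andbF; apply/esym/negbTE/negP => /linear_configP[h' _ _ _].
  move/negP: h; apply.
  by apply/forallP => i; have := h' i (finset.in_setT i); lia.
have {}h i : (x i + m < q.+2)%N by apply/forallP: i.
have subE i j s : (s <= m)%N -> (x i - x j = s%:R) <-> (x i = x j + s :> nat)%N.
  move=> sm; have hj := h j; have hi := ltn_ord (x i).
  split=> [/eqP|e].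
    rewrite subr_eq => /eqP/(congr1 val) /=.
    by rewrite natrZq modnDml modn_small addnC // ; lia.
  apply/eqP; rewrite subr_eq; apply/eqP/val_inj => /=.
  by rewrite natrZq modnDml modn_small addnC // ; lia.
rewrite andbT; apply/cyclic_configP/linear_configP => [cx|[_ _ _ lx] i j s sm ij].
  split=> // [i _|i|i j _ _ ij]; [exact: h|by rewrite inE|].
  wlog le : i j ij / (x j <= x i)%N.
    move=> wl; case: (leqP (x j) (x i)) => [|/ltnW] le; first exact: wl.
    by rewrite orbC wl // eq_sym.
  rewrite /above; case: (leqP (x i - x j) m) => [sm|]; last by lia.
  have [|e ->] := cx i j _ sm ij; first by apply/subE => //; lia.
  by rewrite andbT; lia.
move=> /(subE _ _ _ sm) e.
have := lx i j (finset.in_setT _) (finset.in_setT _) ij; rewrite /above.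
case Gij: (G i j); last by lia.
by split=> //; lia.
Qed.

(** Double counting of the pairs formed by a placement and a free cell.  By
    translation, each cell is free in equally many placements. *)
Lemma card_cyclic_config : (0 < n)%N ->
  #|cyclic_config|%:R = q.+2%:R * (path_poly G).[q.+2%:R - (m * n)%:R - 1] :> int.
Proof.
move=> n_gt0.
have shift c : #|[pred x | cyclic_config x & c \in free_cells x]| =
    #|[pred x | cyclic_config x & -1 \in free_cells x]|.
  pose tr (d : Zq) x : config := [ffun i => x i + d].
  have trK d : cancel (tr d) (tr (- d)).
    by move=> x; apply/ffunP => i; rewrite !ffunE addrK.
  have trNK d : cancel (tr (- d)) (tr d).
    by move=> x; apply/ffunP => i; rewrite !ffunE subrK.
  rewrite -!sum1_card (reindex (tr (c + 1))) /=; last first.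
    by exists (tr (- (c + 1))) => x _; rewrite ?trK ?trNK.
  apply: eq_bigl => x; rewrite !inE; congr (_ && _).
    apply: eq_forallb => i; apply: eq_forallb => j; apply: eq_forallb => s.
    by rewrite !ffunE opprD addrACA subrr addr0.
  apply: eq_forallb => i; apply: eq_forallb => t; rewrite !ffunE.
  rewrite addrAC -subr_eq addrC -[X in _ = (X != _)]addr0 -(subrr c).
  by congr (_ != _); ring.
have dcount : (#|cyclic_config| * (q.+2 - m * n) =
    q.+2 * #|@linear_config n G m q finset.setT q.+1 predT|)%N.
  transitivity (\sum_(x | cyclic_config x) \sum_(c in free_cells x) 1)%N.
    rewrite -sum_nat_const; apply: eq_bigr => x /card_free_cells <-.
    by rewrite sum1_card.
  rewrite (exchange_big_dep predT) //=.
  transitivity (\sum_(c : Zq) #|@linear_config n G m q finset.setT q.+1 predT|)%N.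
    apply: eq_bigr => c _; rewrite sum1_card.
    rewrite -[LHS]/(#|[pred x | cyclic_config x & c \in free_cells x]|) shift.
    rewrite -!sum1_card; apply: eq_bigl => x.
    by rewrite in_linear_config inE cyclic_config_linear.
  by rewrite sum_nat_const card_ord.
have M_neq0 : (q.+2 - m * n)%N%:R != 0 :> int.
  by rewrite pnatr_eq0 subn_eq0 -ltnNge.
apply: (mulIf M_neq0); rewrite -natrM dcount natrM.
rewrite card_linear_config // cardsT card_ord.
rewrite -ltnS mn_q -cover_sum_succ natr1 -subSn // cover_sum_path_poly //.
by rewrite -(natrB _ (ltnW mn_q)); ring.
Qed.

End CyclicConfigurations.

(** * Systems of equations between differences *)

Section DifferenceSystems.
Variable n : nat.
Implicit Types (E : seq ('I_n * 'I_n * nat)) (r : 'I_n -> 'I_n) (h : 'I_n -> int).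

Definition solves (K : comNzRingType) E (x : 'I_n -> K) : Prop :=
  forall i j s, (i, j, s) \in E -> x i - x j = s%:R.

(** Elimination, one equation at a time: a solved system expresses each x_i by the
    representative r i of its class and an integer h i.  A new equation merges two
    classes, is redundant, or implies d = 0 for a nonzero integer d.  As r, h and N
    do not depend on the ring, real dimensions and point counts modulo q are
    read off the same data. *)
Lemma solved_form E :
  (exists r h, [/\ forall i, r (r i) = r i, forall i, h (r i) = 0
     & forall (K : comNzRingType) (x : 'I_n -> K),
         solves E x <-> forall i, x i = x (r i) + (h i)%:~R])
  \/ (exists2 N : nat, (0 < N)%N &
       forall (K : comNzRingType) (x : 'I_n -> K), solves E x -> N%:R = 0 :> K).
Proof.
elim: E => [|[[i j] s] E IH].
  left; exists id, (fun=> 0); split=> // K x; split=> // _ k.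
  by rewrite mulr0z addr0.
have solves_cons (K : comNzRingType) (x : 'I_n -> K) :
    solves ((i, j, s) :: E) x <-> solves E x /\ x i - x j = s%:R.
  split=> [sx|[sx sij] i' j' s'].
    by split=> [i' j' s' h|]; apply: sx; rewrite inE ?h ?orbT ?eqxx.
  by rewrite inE => /orP[/eqP[-> -> ->] //|/sx].
case: IH => [[r [h [rr hr rhE]]]|[N N0 hN]]; last first.
  by right; exists N => // K x /solves_cons[/hN].
have [rij|rij] := eqVneq (r i) (r j).
  have [d0|d0] := eqVneq (h i - h j - s%:Z) 0.
    left; exists r, h; split=> // K x; rewrite solves_cons rhE.
    split=> [[] //|sx]; split=> //.
    rewrite (sx i) (sx j) rij -[s%:R]/(s%:Z%:~R).
    have -> : s%:Z = h i - h j by apply/esym/eqP; rewrite -subr_eq0 d0.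
    by rewrite rmorphB /=; ring.
  right; exists (absz (h i - h j - s%:Z)%R); first by rewrite absz_gt0.
  move=> K x /solves_cons[/rhE sx]; rewrite (sx i) (sx j) rij => e.
  have e0 : (h i - h j - s%:Z)%:~R = 0 :> K.
    by rewrite !rmorphB /= -[s%:Z%:~R]/(s%:R) -e; ring.
  case: (h i - h j - s%:Z) e0 => k //= /eqP.
  by rewrite NegzE mulrNz oppr_eq0 => /eqP.
left; pose c := h j - h i + s%:Z.
have cE (K : pzRingType) : c%:~R = (h j)%:~R - (h i)%:~R + s%:R :> K.
  by rewrite rmorphD rmorphB.
exists (fun k => if r k == r i then r j else r k),
       (fun k => if r k == r i then h k + c else h k); split=> [k|k|K x].
- have [e|ne] := eqVneq (r k) (r i); first by rewrite rr eq_sym (negbTE rij).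
  by rewrite rr (negbTE ne).
- have [e|ne] := eqVneq (r k) (r i); first by rewrite rr eq_sym (negbTE rij) hr.
  by rewrite rr (negbTE ne) hr.
rewrite solves_cons rhE; split=> [[sx e] k|sx].
  case: eqP => // rki; rewrite (sx k) rki rmorphD /= cE -e (sx i) (sx j) /=.
  by rewrite /=; ring.
have xri : x (r i) = x (r j) + c%:~R.
  by have := sx (r i); rewrite rr eqxx hr add0r.
split=> [k|].
  by have := sx k; case: eqP => // -> ->; rewrite xri rmorphD /=; ring.
have := sx i; have := sx j; rewrite eqxx eq_sym (negbTE rij) => -> ->.
by rewrite rmorphD /= cE; ring.
Qed.

Section SolvedForm.
Variables (r : 'I_n -> 'I_n) (h : 'I_n -> int).
Hypotheses (rr : forall i, r (r i) = r i) (hr : forall i, h (r i) = 0).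

Definition free_coords : {set 'I_n} := [set i | r i == i].

Lemma card_solved (K : finComNzRingType) :
  #|[pred x : {ffun 'I_n -> K} | [forall i, x i == x (r i) + (h i)%:~R]]| =
  (#|K| ^ #|free_coords|)%N.
Proof.
rewrite -(card_pffun_on 0 free_coords predT).
pose sol (y : {ffun 'I_n -> K}) := [ffun i => y (r i) + (h i)%:~R].
rewrite -(@card_in_imset _ _ sol [in pffun_on 0 free_coords predT]); last first.
  move=> y z /pffun_onP[/fintype.subsetP y0 _] /pffun_onP[/fintype.subsetP z0 _].
  move=> /ffunP e.
  apply/ffunP => i; have [ri|ri] := eqVneq (r i) i.
    by have := e i; rewrite !ffunE ri => /addIr.
  have nD : i \notin free_coords by rewrite inE.
  rewrite (_ : y i = 0) 1?(_ : z i = 0) //.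
    by apply/eqP; apply: contraNT nD => /z0.
  by apply/eqP; apply: contraNT nD => /y0.
apply: eq_card => x; apply/forallP/imsetP => [sx|[y _ ->] i]; last first.
  by rewrite !ffunE rr hr mulr0z addr0.
exists [ffun i => if r i == i then x i else 0].
  apply/pffun_onP; split=> //; apply/fintype.subsetP => i.
  by rewrite !inE ffunE; case: ifP => //; rewrite eqxx.
by apply/ffunP => i; rewrite !ffunE rr eqxx; apply/eqP.
Qed.

Lemma affine_dim_solved (R : realType) :
  affine_dim [set x : 'rV[R]_n | forall i, x 0 i = x 0 (r i) + (h i)%:~R]%classic =
  #|free_coords|.
Proof.
have rD i : r i \in free_coords by rewrite inE rr.
pose f i := enum_rank_in (rD i) (r i).
have fE i : enum_val (f i) = r i by rewrite enum_rankK_in.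
pose W := (linfun (colsub f : 'rV[R]_#|free_coords| -> 'rV[R]_n) @: fullv)%VS.
have memW w : w \in W <-> forall i, w 0 i = w 0 (r i).
  split=> [/memv_imgP[y _ ->] i|wr].
    rewrite lfunE /= !mxE; congr (y 0 _); apply: enum_val_inj.
    by rewrite !fE rr.
  apply/memv_imgP; exists (\row_k w 0 (enum_val k)); first exact: memvf.
  by apply/rowP => i; rewrite lfunE /= !mxE fE.
have dimW : \dim W = #|free_coords|.
  rewrite limg_dim_eq ?dimvf ?dim_matrix ?mul1r //.
  apply/eqP; rewrite capfv; apply/lker0P => y z; rewrite !lfunE /= => /rowP e.
  apply/rowP => k; have := e (enum_val k); rewrite !mxE.
  suff -> : f (enum_val k) = k by [].
  apply: enum_val_inj; rewrite fE; apply/eqP.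
  by have := enum_valP k; rewrite inE.
rewrite -dimW -(affine_dimE (\row_i (h i)%:~R) W); congr (affine_dim _).
apply/seteqP; split=> x /=.
  move=> sx; apply/memW => i; rewrite !mxE hr mulr0z subr0.
  by rewrite (sx i) addrK.
move=> /memW sx i; have := sx i; rewrite !mxE hr mulr0z subr0 => <-.
by rewrite subrK.
Qed.

End SolvedForm.
End DifferenceSystems.

(** * Whitney's formula *)

Lemma alternating_sum_subsets (T : finType) (A : {set T}) :
  \sum_(B : {set T} | B \subset A) (-1) ^+ #|B| = (A == set0)%:R :> int.
Proof.
transitivity (\prod_(i : T) ((if i \in A then -1 else 0) + 1) : int).
  rewrite bigA_distr big_mkcond; apply: eq_bigr => B _.
  rewrite -big_mkcond /=; case: ifPn => [/fintype.subsetP sBA|].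
    rewrite -prodr_const; apply: eq_bigr => i /sBA ->; by [].
  by move=> /fintype.subsetPn[i iB iA]; rewrite (bigD1 i) //= (negbTE iA) mul0r.
have [->|[i iA]] := set_0Vmem A.
  by rewrite eqxx big1 // => i _; rewrite inE add0r.
rewrite (bigD1 i) //= iA addNr mul0r; case: eqP => // A0.
by move: iA; rewrite A0 inE.
Qed.

Section Whitney.
Local Open Scope classical_set_scope.
Variables (R : realType) (n : nat) (I : finType) (D : {set I}).
Local Notation V := 'rV[R]_n.
Local Notation setT := classical_sets.setT.
Variable (H : I -> set V).
Implicit Types (B : {set I}) (X : set V).
Hypothesis HT : forall e, e \in D -> H e <> setT.

Definition flat (B : {set I}) : set V := [set v | forall e, e \in B -> H e v].

Definition arrangement : set (set V) := [set X | exists2 e, e \in D & X = H e].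

Local Notation L := (intersection_poset arrangement).

Lemma flatsP X : L X <-> X !=set0 /\ exists2 B : {set I}, B \subset D & X = flat B.
Proof.
split=> -[X0 [B BD eX]]; split=> //; rewrite eX.
  exists (finset.finset (fun e => (e \in D) && `[< B (H e) >])).
    by apply/fintype.subsetP => e; rewrite inE => /andP[].
  apply/seteqP; split=> v hv.
    by move=> e; rewrite inE => /andP[_ /asboolP]; apply: hv.
  move=> Y BY; have [e eD eY] := BD Y BY; rewrite eY; apply: hv.
  by rewrite inE eD /=; apply/asboolP; rewrite -eY.
exists [set X | exists2 e, e \in B & X = H e].
  by move=> _ [e eB ->]; exists e => //; apply: (fintype.subsetP BD).
apply/seteqP; split=> v hv; first by move=> _ [e eB ->]; apply: hv.
by move=> e eB; apply: hv; exists e.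
Qed.

Lemma flats_finite : finite_set L.
Proof.
apply: (@sub_finite_set _ _ (flat @` setT)); last exact: finite_image finite_finset.
by move=> X /flatsP[_ [B _ ->]]; exists B.
Qed.

Lemma sum_by_flat (M : nmodType) (P : set (set V)) (w : set V -> {set I} -> M) :
    finite_set P ->
  \sum_(Y \in P) \sum_(B : {set I} | (B \subset D) && (flat B == Y)) w Y B =
  \sum_(B : {set I} | (B \subset D) && (flat B \in P)) w (flat B) B.
Proof.
move=> Pfin; rewrite fsbig_finite //.
rewrite (exchange_big_dep (fun B : {set I} => B \subset D)) /=; last first.
  by move=> Y B _ /andP[].
rewrite [RHS]big_mkcondr; apply: eq_bigr => B BD.
under eq_bigl => Y do rewrite BD /=.
case: ifPn => BP.
  rewrite big_mkcond (bigD1_seq (flat B)) ?fset_uniq ?in_fset_set //= eqxx.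
  by rewrite big1 ?addr0 // => Y /negbTE neY; rewrite eq_sym neY.
rewrite big1_seq // => Y /andP[/eqP <-].
by rewrite in_fset_set // (negbTE BP).
Qed.

(** The hyperplanes through X.  As they determine a flat X, their number grows
    strictly along the intersection poset and can drive an induction on it. *)
Definition locus X : {set I} := finset.finset (fun e => (e \in D) && `[< X `<=` H e >]).

Lemma flat_locus X : L X -> flat (locus X) = X.
Proof.
move=> /flatsP[_ [B BD ->]]; apply/seteqP; split=> v hv e; last first.
  by rewrite inE => /andP[_ /asboolP]; apply.
move=> eB; apply: hv; rewrite inE (fintype.subsetP BD) //=.
by apply/asboolP => u; apply.
Qed.

Lemma sub_locus B X : (B \subset locus X) = (B \subset D) && `[< X `<=` flat B >].
Proof.
apply/fintype.subsetP/andP => [h|[/fintype.subsetP BD /asboolP XB] e eB].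
  split; first by apply/fintype.subsetP => e /h; rewrite inE => /andP[].
  apply/asboolP => v Xv e /h; rewrite inE => /andP[_ /asboolP]; exact.
by rewrite inE BD //=; apply/asboolP => v /XB; apply.
Qed.

(** The right-hand side obeys the recursion of the Moebius function: its sum over
    the flats that contain X is the alternating sum over the subsets of
    [locus X], which vanishes unless X is the whole space. *)
Lemma mobius_flat X : L X ->
  mobius L (fun X Y => Y `<=` X) setT X =
  \sum_(B : {set I} | (B \subset D) && (flat B == X)) (-1) ^+ #|B|.
Proof.
have [k] := ubnP #|locus X|; elim: k X => // k IH X; rewrite ltnS => leXk LX.
rewrite mobiusE //; first last.
- by move=> Y Z ZY YZ; apply/seteqP.
- by move=> Y Z W YX ZY; apply: classical_sets.subset_trans ZY YX.
- exact: flats_finite.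
have tot : \sum_(B : {set I} | B \subset locus X) (-1) ^+ #|B| = (setT == X)%:R :> int.
  rewrite alternating_sum_subsets; congr (nat_of_bool _)%:R.
  apply/eqP/eqP => [X0|<-].
    rewrite -(flat_locus LX) X0.
    by apply/seteqP; split=> // v _ e; rewrite finset.inE.
  apply/setP => e; rewrite !inE; apply/negP => /andP[eD /asboolP sT].
  by apply: (HT eD); apply/seteqP; split.
move: tot; under eq_bigl => B do rewrite sub_locus.
rewrite (bigID (fun B => flat B == X)) /=.
rewrite (eq_bigl (fun B : {set I} => (B \subset D) && (flat B == X))); last first.
  move=> B; rewrite -andbA; congr (_ && _); apply: andb_idl => /eqP ->.
  exact/asboolP.
case: eqP => [eX tot|neX tot].
  rewrite -[LHS]/(true%:R : int) -[LHS]tot [X in _ + X]big1 ?addr0 // => B.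
  move=> /andP[/andP[_ /asboolP]].
  by rewrite -eX => sB /eqP[]; apply/seteqP; split.
move/eqP: tot; rewrite mulr0n addr_eq0 => /eqP ->; congr (- _).
set P := [set Y | _].
have Pfin : finite_set P by apply: sub_finite_set flats_finite => Y [].
transitivity (\sum_(Y \in P) \sum_(B : {set I} | (B \subset D) && (flat B == Y))
   ((-1) ^+ #|B| : int)).
  apply: eq_fsbigr => Y /set_mem [LY _ XY neXY]; apply: IH => //.
  apply: leq_trans leXk; apply: proper_card; rewrite properE; apply/andP; split.
    apply/fintype.subsetP => e; rewrite !inE => /andP[-> /asboolP h] /=.
    by apply/asboolP; apply: classical_sets.subset_trans XY h.
  apply: contrapT => /negP; rewrite negbK => /fintype.subsetP sXY.
  apply: neXY; apply/seteqP; split=> // v; rewrite -(flat_locus LY) => Yv.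
  by rewrite -(flat_locus LX) => e /sXY; apply: Yv.
rewrite sum_by_flat //; apply: eq_bigl => B; rewrite -andbA; apply: andb_id2l => BD.
apply/idP/andP => [/set_mem [_ _ XB ne]|[/asboolP XB /eqP ne]].
  by split; [apply/asboolP|apply/eqP].
apply/mem_set; split=> //; apply/flatsP; split; last by exists B.
by have /flatsP[[v Xv] _] := LX; exists v; apply: XB.
Qed.

(** The family H may repeat hyperplanes, as the formula sums over sets of indices;
    this is convenient because (i, j, 0) and (j, i, 0) give the same one. *)
Theorem whitney_formula : char_poly_arr arrangement =
  \sum_(B : {set I} | (B \subset D) && `[< flat B !=set0 >])
     (-1) ^+ #|B| *: 'X^(affine_dim (flat B)).
Proof.
rewrite /char_poly_arr.
transitivity (\sum_(X \in L) \sum_(B : {set I} | (B \subset D) && (flat B == X))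
   ((-1) ^+ #|B| *: 'X^(affine_dim X) : {poly int})).
  by apply: eq_fsbigr => X /set_mem LX; rewrite mobius_flat // scaler_suml.
rewrite sum_by_flat; last exact: flats_finite.
apply: eq_bigl => B; apply: andb_id2l => BD.
apply/idP/asboolP => [/set_mem/flatsP[] //|B0].
by apply/mem_set/flatsP; split=> //; exists B.
Qed.

End Whitney.

(** * The characteristic polynomial *)

Section CatalanCharPoly.
Variables (R : realType) (n : nat) (G : rel 'I_n) (m : nat).
Hypothesis m_gt0 : (0 < m)%N.
Local Notation edge := ('I_n * 'I_n * 'I_m.+1)%type.
Implicit Types B : {set edge}.

Definition catalan_edges : {set edge} :=
  [set e : edge | (e.1.1 != e.1.2) && ~~ ((e.2 == m :> nat) && G e.1.1 e.1.2)].

Definition edge_hyperplane (e : edge) : set 'rV[R]_n :=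
  diff_hyperplane R e.1.1 e.1.2 e.2.

Lemma diff_hyperplane_neqT (i j : 'I_n) s :
  i != j -> diff_hyperplane R i j s <> classical_sets.setT.
Proof.
move=> ij e.
have : diff_hyperplane R i j s (\row_k (if k == i then s.+1%:R else 0)) by rewrite e.
rewrite /diff_hyperplane /= !mxE eqxx eq_sym (negbTE ij) subr0.
by move/eqP; rewrite eqr_nat; lia.
Qed.

(** Deleting hyperplanes as sets amounts to deleting their labels.  Only s' > 0 can
    be allowed, as x_i = x_j and x_j = x_i define the same hyperplane. *)
Lemma diff_hyperplane_inj (i j i' j' : 'I_n) s s' : i != j -> (0 < s')%N ->
  diff_hyperplane R i j s = diff_hyperplane R i' j' s' ->
  [/\ i = i', j = j' & s = s'].
Proof.
move=> ij s'_gt0 eH.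
have ji : (j == i) = false by rewrite eq_sym (negbTE ij).
have sub (x : 'rV[R]_n) : x 0 i - x 0 j = s%:R -> x 0 i' - x 0 j' = s'%:R :> R.
  by move=> hx; rewrite -[_ = _]/(diff_hyperplane R i' j' s' x) -eH.
(* The points s e_i and s e_i + (e_i + e_j) of the first hyperplane suffice. *)
have := sub (\row_k (s * (k == i))%N%:R); rewrite !mxE eqxx ji muln1 muln0 subr0.
move=> /(_ erefl) /eqP.
have := sub (\row_k (s * (k == i) + ((k == i) || (k == j)))%N%:R).
rewrite !mxE !eqxx ji muln1 muln0 add0n /= natrD addrK => /(_ erefl) /eqP.
rewrite !subr_eq -!natrD !eqr_nat.
case: (eqVneq i' i) => [->|_]; last by rewrite !muln0; lia.
case: (eqVneq j' i) => _; first by lia.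
by case: (eqVneq j' j) => [-> _ es|_]; [split=> //|]; lia.
Qed.

Lemma catalan_del_arrangement :
  catalan_del R m G = arrangement catalan_edges edge_hyperplane.
Proof.
apply/seteqP; split=> X.
  move=> [+ ndel] => -[[i [j [ij eX]]]|[i [j [s [ij /andP[s0 sm] eX]]]]].
    exists (i, j, ord0) => //=.
    by rewrite inE /= neq_ltn ij /= eq_sym (gtn_eqF m_gt0).
  exists (i, j, Ordinal (sm : s < m.+1)%N) => //=.
  rewrite inE /= ij /=; apply/andP => -[/eqP es Gij]; apply: ndel.
  by exists i, j; rewrite -es.
move=> [[[i j] s]]; rewrite inE /edge_hyperplane /= => /andP[ij nG] eX.
have sm : (s <= m)%N by rewrite -ltnS.
split; last first.
  move=> [i' [j' [Gij']]]; rewrite eX => /(diff_hyperplane_inj ij m_gt0)[ei ej es].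
  by move: nG; rewrite ei ej es Gij' eqxx.
have [s0|s0] := posnP s; last by right; exists i, j, s; rewrite ij s0 sm.
left; move: ij; rewrite neq_ltn => /orP[ij|ji].
  by exists i, j; rewrite eX s0.
exists j, i; split=> //; rewrite eX s0; apply/seteqP.
by split=> x; rewrite /diff_hyperplane /= => /eqP; rewrite subr_eq0 => /eqP ->;
  rewrite subrr.
Qed.

Definition edge_solutions q B : {set {ffun 'I_n -> 'I_q.+2}} :=
  [set x : {ffun 'I_n -> 'I_q.+2} |
     [forall e in B, x e.1.1 - x e.1.2 == (e.2 : nat)%:R]].

(** The two cases of [solved_form]: consistency over the reals is consistency modulo
    every large q. *)
Lemma card_edge_solutions B : exists N, forall q, (N <= q)%N ->
  #|edge_solutions q B| =
  if `[< flat edge_hyperplane B !=set0 >]%classic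
  then (q.+2 ^ affine_dim (flat edge_hyperplane B))%N else 0%N.
Proof.
pose E : seq ('I_n * 'I_n * nat) :=
  [seq (e.1.1, e.1.2, (e.2 : nat)) | e : edge <- enum B].
have EB (K : comNzRingType) (x : 'I_n -> K) :
    solves E x <-> forall e, e \in B -> x e.1.1 - x e.1.2 = (e.2 : nat)%:R.
  split=> [sx e eB|sx i j s /mapP[e]].
    by apply: sx; apply/mapP; exists e; rewrite ?mem_enum.
  by rewrite mem_enum => eB [-> -> ->]; apply: sx.
have flatE x : flat edge_hyperplane B x <-> solves E (fun i => x 0 i).
  by rewrite EB.
have solE q (x : {ffun 'I_n -> 'I_q.+2}) : (x \in edge_solutions q B) <-> solves E x.
  rewrite EB inE; split=> [/forall_inP h e /h/eqP //|h].
  by apply/forall_inP => e /h ->.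
have [[r [h [rr hr rhE]]]|[N N0 hN]] := solved_form E.
  have -> : flat edge_hyperplane B =
      [set x : 'rV[R]_n | forall i, x 0 i = x 0 (r i) + (h i)%:~R]%classic.
    by apply/seteqP; split=> x /=; rewrite -rhE flatE.
  exists 0%N => q _; rewrite affine_dim_solved // asboolT; last first.
    exists (\row_i (h i)%:~R) => i; by rewrite !mxE hr add0r.
  rewrite -[q.+2 in RHS]card_ord -(card_solved rr hr).
  apply: eq_card => x; rewrite [RHS]inE.
  by apply/idP/forallP => [/solE/rhE sx i|sx];
     [apply/eqP|apply/solE/rhE => i; apply/eqP].
exists N => q Nq; rewrite asboolF; last first.
  move=> [x /flatE/hN /eqP]; rewrite pnatr_eq0; lia.
apply: eq_card0 => x; apply/negP => /solE/hN/(congr1 val) /=.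
rewrite natrZq modn_small; lia.
Qed.

(** Inclusion-exclusion: exchanging the sums leaves, for each x, the alternating sum
    over the sets of equations that x satisfies. *)
Lemma sum_edge_solutions q :
  \sum_(B : {set edge} | B \subset catalan_edges)
     (-1) ^+ #|B| * #|edge_solutions q B|%:R =
  #|@cyclic_config n G m q|%:R :> int.
Proof.
pose bad (x : {ffun 'I_n -> 'I_q.+2}) :=
  [set e : edge in catalan_edges | x e.1.1 - x e.1.2 == (e.2 : nat)%:R].
transitivity (\sum_x \sum_(B : {set edge} | B \subset bad x) (-1) ^+ #|B| : int).
  rewrite (exchange_big_dep [pred B : {set edge} | B \subset catalan_edges]) /=;
    last first.
    move=> x B _ /fintype.subsetP h; apply/fintype.subsetP => e /h.
    by rewrite inE => /andP[].
  apply: eq_bigr => B /fintype.subsetP BD; rewrite mulr_natr -sumr_const.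
  apply: eq_bigl => x; rewrite inE; apply/forall_inP/fintype.subsetP => h e eB.
    by rewrite inE BD // h.
  by have := h e eB; rewrite inE => /andP[].
rewrite -sum1_card natr_sum [RHS]big_mkcond; apply: eq_bigr => x _.
rewrite alternating_sum_subsets -[x \in _]/(cyclic_config G m x).
suff -> : cyclic_config G m x = (bad x == set0) by case: eqP.
apply/idP/eqP => [/cyclic_configP cx|bad0].
  apply/setP => -[[i j] s]; rewrite !inE /=; apply/negP => /andP[/andP[ij nG] /eqP e].
  have [es Gij] := cx i j s (ltn_ord s) ij e.
  by move: nG; rewrite es eqxx Gij.
apply/cyclic_configP => i j s sm ij e.
have : (i, j, Ordinal (sm : s < m.+1)%N) \notin bad x by rewrite bad0 inE.
by rewrite !inE /= ij e eqxx andbT negbK => /andP[/eqP].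
Qed.

Lemma poly_int_eq (p p' : {poly int}) N :
  (forall k, (N <= k)%N -> p.[k%:R] = p'.[k%:R]) -> p = p'.
Proof.
move=> e; apply/eqP; rewrite -subr_eq0; apply/eqP.
apply: (@roots_geq_poly_eq0 _ _ [seq k%:R | k <- iota N (size (p - p'))]).
- apply/allP => _ /mapP[k + ->]; rewrite mem_iota => /andP[Nk _].
  by rewrite rootE hornerD hornerN e // subrr.
- by rewrite map_inj_uniq ?iota_uniq // => k l /eqP; rewrite eqr_nat => /eqP.
- by rewrite size_map size_iota.
Qed.

Theorem char_poly_catalan_del : (0 < n)%N ->
  char_poly_arr (catalan_del R m G) =
  'X * (path_poly G \Po ('X - ((m * n)%:R + 1)%:P)).
Proof.
move=> n_gt0; have [N hN] := fin_all_exists card_edge_solutions.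
(* The point counts are those of Z/(q+2), whence the shift by two. *)
apply: (@poly_int_eq _ _ (maxn (\max_B N B) (m * n)).+2) => -[|[|q]] //.
rewrite !ltnS geq_max => /andP[leN lemn].
rewrite hornerM hornerX horner_comp hornerXsubC opprD addrA.
rewrite -card_cyclic_config //; last by rewrite ltnS leqW.
rewrite -sum_edge_solutions catalan_del_arrangement whitney_formula; last first.
  by move=> [[i j] s]; rewrite inE => /andP[ij _]; apply: diff_hyperplane_neqT.
rewrite horner_sum big_mkcondr; apply: eq_bigr => B BD /=.
rewrite hN; last by apply: leq_trans leN; apply: leq_bigmax.
case: asboolP => _; last by rewrite mulr0.
by rewrite hornerZ hornerXn natrX.
Qed.

End CatalanCharPoly.

(** * Translation of factors and roots *)

Lemma comp_XsubC_inj (A : comNzRingType) (c : A) (p p' : {poly A}) :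
  p \Po ('X - c%:P) = p' \Po ('X - c%:P) -> p = p'.
Proof.
move=> /(congr1 (fun u => u \Po ('X + c%:P))).
rewrite /= -!comp_polyA !comp_polyB !comp_polyX !comp_polyC addrK.
by rewrite !comp_polyXr => ->.
Qed.

Lemma comp_prod_XsubC (A : comNzRingType) (c : A) (s : seq A) :
  (\prod_(a <- s) ('X - a%:P)) \Po ('X - c%:P) =
  \prod_(a <- [seq a + c | a <- s]) ('X - a%:P).
Proof.
rewrite big_map rmorph_prod; apply: eq_bigr => a _ /=.
by rewrite comp_polyB comp_polyX comp_polyC polyCD opprD addrCA addrC.
Qed.

Lemma splits_int_shift (p : {poly int}) c :
  splits_int ('X * (p \Po ('X - c%:P))) <-> splits_int p.
Proof.
split=> [[s es]|[s ->]]; last first.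
  exists (0 :: [seq a + c | a <- s]).
  by rewrite big_cons subr0 comp_prod_XsubC.
have s0 : 0 \in s by rewrite -root_prod_XsubC -es rootE hornerM hornerX mul0r.
exists [seq a - c | a <- rem 0 s]; apply: (@comp_XsubC_inj _ c).
rewrite comp_prod_XsubC -map_comp map_id_in; last by move=> a _ /=; rewrite subrK.
apply: (@mulfI _ 'X); first by rewrite polyX_eq0.
by rewrite es (perm_big _ (perm_to_rem s0)) big_cons subr0.
Qed.

Lemma complex_roots_perm (R : realType) (p : {poly int}) a (t : seq (complex R)) :
  a != 0 -> map_poly intr p = a *: \prod_(z <- t) ('X - z%:P) ->
  perm_eq (complex_roots R p) t.
Proof.
move=> a0; rewrite /complex_roots; case: closed_field_poly_normal => s /= + e.
rewrite e lead_coefZ (monicP (monic_prod_XsubC _ _ _)) mulr1 => es.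
by apply: prod_XsubC_eq; apply: (scalerI a0).
Qed.

(** Since -mn P(G, -mn - 1) is the cover sum of all the vertices at -mn, and
    mn >= n. *)
Lemma path_poly_neg_neq0 n (G : rel 'I_n) m : (0 < n)%N -> (0 < m)%N ->
  (path_poly G).[- ((m * n)%:R + 1)] != 0.
Proof.
move=> n0 m0; have := @cover_sum_neg_neq0 n G setT (m * n).
rewrite cardsT card_ord leq_pmull // cover_sum_path_poly // => /(_ isT).
by rewrite mulf_eq0 negb_or opprD => /andP[].
Qed.

(** The roots of chi are 0 and the translates of the roots of P; by
    [path_poly_neg_neq0] none of the latter is 0. *)
Lemma nonzero_roots_catalan_del (R : realType) n (G : rel 'I_n) m
    (t : seq (complex R)) : (0 < n)%N -> (0 < m)%N ->
  map_poly intr (path_poly G) =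
    lead_coef (map_poly intr (path_poly G)) *: \prod_(z <- t) ('X - z%:P) ->
  perm_eq (nonzero_roots R (char_poly_arr (catalan_del R m G)))
          [seq z + ((m * n)%:R + 1) | z <- t].
Proof.
move=> n0 m0; set a := lead_coef _ => et.
have Pc := path_poly_neg_neq0 G n0 m0.
have a0 : a != 0.
  rewrite lead_coef_eq0 map_poly_eq0_id0; last first.
    by rewrite intr_eq0 lead_coef_eq0; apply: contraNneq Pc => ->; rewrite horner0.
  by apply: contraNneq Pc => ->; rewrite horner0.
set c : complex R := (m * n)%:R + 1.
have cE : c = ((m * n)%:R + 1 : int)%:~R by rewrite rmorphD /= rmorph_nat.
have tc : 0 \notin [seq z + c | z <- t].
  apply/mapP => -[z zt /eqP]; rewrite eq_sym addr_eq0 => /eqP ez.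
  have : root (map_poly intr (path_poly G)) z.
    by rewrite et rootZ // root_prod_XsubC.
  rewrite ez cE -rmorphN rootE horner_map intr_eq0; exact/negP.
have perm0 : perm_eq (complex_roots R (char_poly_arr (catalan_del R m G)))
    (0 :: [seq z + c | z <- t]).
  apply: (complex_roots_perm a0); rewrite char_poly_catalan_del // rmorphM /=.
  rewrite map_polyX map_comp_poly rmorphB /= map_polyX map_polyC /= -cE et.
  by rewrite linearZ /= comp_prod_XsubC big_cons subr0 -scalerAr.
rewrite (perm_trans (perm_filter _ perm0)) //= eqxx /=.
rewrite (_ : [seq z <- _ | _] = [seq z + c | z <- t]) //.
by apply/all_filterP/allP => z zt; apply: contraNneq tc => <-.
Qed.

Theorem corollary2p4 (R : realType) (n : nat) (G : rel 'I_n)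
    (hn : (1 <= n)%N) (hG : irreflexive G) :
  [/\ forall (m : nat) (alpha : 'I_n.-1 -> int), (1 <= m)%N ->
        path_poly G = \prod_(j < n.-1) ('X + (alpha j)%:P)
        <->
        char_poly_arr (catalan_del R m G) =
          'X * \prod_(j < n.-1) ('X - (m * n)%:R - 1 + (alpha j)%:P),
      forall m m' : nat, (1 <= m)%N -> (1 <= m')%N ->
        splits_int (char_poly_arr (catalan_del R m G)) <->
        splits_int (char_poly_arr (catalan_del R m' G))
    & forall m m' : nat, (1 <= m)%N -> (1 <= m')%N ->
        exists c : complex R,
          perm_eq
            (nonzero_roots R (char_poly_arr (catalan_del R m' G)))
            [seq z + c | z <- nonzero_roots R
                                (char_poly_arr (catalan_del R m G))]].
Proof.
split=> [m alpha m0|m m' m0 m0'|m m' m0 m0'].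
- have shiftE : \prod_(j < n.-1) ('X - (m * n)%:R - 1 + (alpha j)%:P) =
      (\prod_(j < n.-1) ('X + (alpha j)%:P)) \Po ('X - ((m * n)%:R + 1)%:P).
    rewrite rmorph_prod; apply: eq_bigr => j _ /=.
    by rewrite comp_polyD comp_polyX comp_polyC polyCD polyC_natr opprD addrA.
  rewrite char_poly_catalan_del // shiftE; split=> [-> //|].
  by move=> /(mulfI (negbT (polyX_eq0 _))) /comp_XsubC_inj.
- by rewrite !char_poly_catalan_del // !splits_int_shift.
- have [t et] :=
    closed_field_poly_normal (map_poly (intr : int -> complex R) (path_poly G)).
  exists ((m' * n)%:R - (m * n)%:R).
  apply: (perm_trans (nonzero_roots_catalan_del hn m0' et)).
  rewrite perm_sym (perm_trans (perm_map _ (nonzero_roots_catalan_del hn m0 et))) //.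
  rewrite -map_comp (_ : map _ t = [seq z + ((m' * n)%:R + 1) | z <- t]) //.
  by apply: eq_map => z /=; ring.
Qed.
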